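(* Let $\alpha>0$, $\beta>0$ and $\lambda\in\mathbb{R}$. The auxiliary quantities $r_n(\lambda)$ and $R_n(\lambda)$ satisfy the coupled difference equations $$\lambda(r_{n+1}+r_n)=R_n^2-R_n(2n+1+\alpha+\beta+\lambda)+\lambda\alpha\qquad(n\ge0),$$ $$n(n+\beta)+(2n+\alpha+\beta)r_n=(r_n^2-\alpha r_n)\left(\frac{\lambda^2}{R_nR_{n-1}}-\frac{\lambda}{R_n}-\frac{\lambda}{R_{n-1}}\right)\qquad(n\ge1),$$ with the initial conditions $$r_0(\lambda)=0,\qquad R_0(\lambda)=\frac{(\alpha+\beta+1)\,M(\alpha;1+\alpha+\beta;-\lambda)}{M(1+\alpha;2+\alpha+\beta;-\lambda)},$$ where $M(a;b;z)=\sum_{k\ge0}\frac{(a)_k}{(b)_k}\frac{z^k}{k!}$ is the Kummer function.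
   Context: $w(x)=x^{\alpha}(1-x)^{\beta}e^{-\lambda x}$ on $[0,1]$; $P_n$ is the monic orthogonal polynomial of degree $n$ for $w$ on $[0,1]$ (depending on $\lambda$), and $h_n=\int_0^1P_n^2w\,dx$. The auxiliary quantities are $$R_n(\lambda)=\frac{\alpha}{h_n}\int_0^1\frac{P_n^2(y)}{y}w(y)\,dy\ (n\ge 0),\qquad r_n(\lambda)=\frac{\alpha}{h_{n-1}}\int_0^1\frac{P_n(y)P_{n-1}(y)}{y}w(y)\,dy\ (n\ge1),\qquad r_0:=0$$ (the value $r_0=0$ is the convention corresponding to $P_{-1}=0$). *)

(* Defs.v *)
From HB Require Import structures.
From mathcomp Require Import all_boot all_order all_algebra.
From mathcomp Require Import all_classical all_reals all_analysis.

Set Implicit Arguments.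
Unset Strict Implicit.
Unset Printing Implicit Defensive.

Import Order.TTheory GRing.Theory Num.Theory.
Import numFieldNormedType.Exports.

Local Open Scope classical_set_scope.
Local Open Scope ring_scope.

Definition weight (R : realType) (alpha beta lambda x : R) : R :=
  x `^ alpha * (1 - x) `^ beta * expR (- (lambda * x)).

(* The integrals below are Lebesgue integrals: for 0 < alpha < 1 the integrands
   containing weight y / y are unbounded at 0, but integrable. *)
Definition int01 (R : realType) (f : R -> R) : R :=
  \int[@lebesgue_measure R]_(x in `[0, 1]) f x.

Definition monic_orthogonal (R : realType) (alpha beta lambda : R)
    (P : nat -> {poly R}) : Prop :=
  (forall n, P n \is monic /\ size (P n) = n.+1) /\
  (forall m n, m != n ->
     int01 (fun x => (P m).[x] * (P n).[x] * weight alpha beta lambda x) = 0).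

Definition sqnorm (R : realType) (alpha beta lambda : R)
    (P : nat -> {poly R}) (n : nat) : R :=
  int01 (fun x => (P n).[x] ^+ 2 * weight alpha beta lambda x).

Definition aux_R (R : realType) (alpha beta lambda : R)
    (P : nat -> {poly R}) (n : nat) : R :=
  alpha / sqnorm alpha beta lambda P n *
  int01 (fun y => (P n).[y] ^+ 2 / y * weight alpha beta lambda y).

Definition aux_r (R : realType) (alpha beta lambda : R)
    (P : nat -> {poly R}) (n : nat) : R :=
  if n is m.+1 then
    alpha / sqnorm alpha beta lambda P m *
    int01 (fun y => (P m.+1).[y] * (P m).[y] / y * weight alpha beta lambda y)
  else 0.

Definition pochhammer (R : realType) (a : R) (k : nat) : R :=
  \prod_(i < k) (a + i%:R).

Definition kummer (R : realType) (a b z : R) : R :=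
  limn (series (fun k => pochhammer a k / pochhammer b k * (z ^+ k / k`!%:R))).

(* Main.v *)
(** The weight satisfies the Pearson identity
      [\int (q' (1 - x) x - q x + q (alpha (1 - x) - beta x - lambda x (1 - x))) w / x = 0],
    obtained by integrating [(q (1 - x) w)'] over [0, 1], so everything reduces to
    the moment functional [M p = \int p w / x] and to [L p = M (x p)], for which the
    [P n] are orthogonal.  Write [h n] for the squared norms, [a n] for the diagonal
    recurrence coefficients and [p n] for the subleading coefficient of [P n].  The
    Pearson identity with [q = P n ^ 2] gives
      [lambda a n = 2 n + 1 + alpha + beta + lambda - R n],
    and pairing the three-term recurrence with [P n] under [M] gives
      [r (n + 1) + r n = alpha - a n R n]: this is the first equation.
    With [q = P n P (n - 1)] it gives [n + p n + r n = - lambda h n / h (n - 1)].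
    Since [M ((x - 0) q) = L q], orthogonality makes [M (P n q)] depend on [q] only
    through [q(0)] (up to a multiple of [h n]), whence
      [r n (r n - alpha) = h n / h (n - 1) R n R (n - 1)];
    the same argument at the endpoint 1, with [\int p w / (1 - x)], yields
      [(r n + n) (r n + n + beta)
         = h n / h (n - 1) (R n - lambda) (R (n - 1) - lambda)].
    Their difference is the second equation.  The value of [R 0] follows by
    expanding [exp (- lambda x)] and computing the beta moments at [lambda = 0] from
    the Pearson identity. *)

Require Import Defs.
From HB Require Import structures.
From mathcomp Require Import all_boot all_order all_algebra.
From mathcomp Require Import all_classical all_reals all_analysis measurable_realfun.
From mathcomp Require Import ring.

Set Implicit Arguments.
Unset Strict Implicit.
Unset Printing Implicit Defensive.

Import Order.TTheory GRing.Theory Num.Theory.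
Import numFieldNormedType.Exports.

Local Open Scope ring_scope.

(** * Fundamental theorem of calculus for an integrand singular at the left endpoint *)

Section ImproperFTC.
Local Open Scope classical_set_scope.
Variable R : realType.
Notation mu := (@lebesgue_measure R).

(** The integrand may blow up at [a], so the classical theorem is applied on [[x, b]]; then [x]
    tends to [a], since the integral of an integrable function over [[a, x]] tends to 0. *)
Lemma Rintegral_FTC2_left (f F : R -> R) (a b : R) : a < b ->
  mu.-integrable `[a, b] (EFin \o f) ->
  (forall x, a < x -> x < b -> {within `[x, b], continuous f}) ->
  F x @[x --> a^'+] --> F a -> F x @[x --> b^'-] --> F b ->
  (forall x, a < x -> x < b -> is_derive x 1 F (f x)) ->
  \int[mu]_(x in `[a, b]) f x = F b - F a.
Proof.
move=> ab intf cf Fa Fb dF.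
have Ga : \int[mu]_(t in `[a, x]) f t @[x --> a^'+] --> (0 : R).
  by apply: cvg_within_filter; exact: parameterized_integral_cvg_left ab intf.
have cvFG : (F b - F x + \int[mu]_(t in `[a, x]) f t) @[x --> a^'+] --> F b - F a.
  rewrite -[X in _ --> X]addr0.
  by apply: cvgD => //; apply: cvgB => //; exact: cvg_cst.
apply: (cvg_unique _ _ cvFG) => //; apply: cvg_near_cst; near=> x.
have ax : a < x by near: x; exact: nbhs_right_gt.
have xb : x < b by near: x; exact: nbhs_right_lt.
apply/esym.
have := @Rintegral_itvB R f (BLeft a) (BRight b) x intf.
rewrite !bnd_simp => /(_ (ltW ax) (ltW xb)) /eqP.
rewrite subr_eq => /eqP ->; congr (_ + _).
rewrite Rintegral_itv_obnd_cbnd; last first.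
  apply: integrableS intf => //.
  by apply: subset_itv; rewrite bnd_simp // ltW.
rewrite /Rintegral (@continuous_FTC2 _ f F x b xb (cf x ax xb)) //.
  split => //.
  - move=> y; rewrite in_itv/= => /andP[xy yb].
    by have [] := dF y (lt_trans ax xy) yb.
  - apply: cvg_at_right_filter; apply: differentiable_continuous.
    by apply/derivable1_diffP; have [] := dF x ax xb.
move=> y; rewrite in_itv/= => /andP[xy yb].
by rewrite derive1E; have [_] := dF y (lt_trans ax xy) yb.
Unshelve. all: by end_near. Qed.
End ImproperFTC.

(** * Integrability of the kernel x^a / x on [0, 1] *)

Section JacobiKernel.
Local Open Scope classical_set_scope.
Variable R : realType.
Notation mu := (@lebesgue_measure R).
Implicit Types (a x : R).

Lemma measurable_powR_div a :
  measurable_fun (`[0, 1] : set R) (fun x => x `^ a / x).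
Proof.
apply: (@eq_measurable_fun _ _ _ _ _ (fun x => x `^ a * x `^ (- 1))).
  by move=> x; rewrite inE/= in_itv/= => /andP[x0 _]; rewrite powR_inv1.
by apply: measurable_funM; apply: measurable_funTS; exact: measurable_powR.
Qed.

Lemma is_derive_powR_div a x : 0 < x ->
  is_derive x 1 (fun y : R => y `^ a) (a * (x `^ a / x)).
Proof.
move=> x0; have -> : x `^ a / x = x `^ (a - 1).
  by rewrite powRB ?(gt_eqF x0) ?implybT // powRr1 // ltW.
exact: is_derive1_powR.
Qed.

Lemma powR_div_itvE a (e : R) : 0 < a -> 0 < e -> e < 1 ->
  (\int[mu]_(x in `[e, 1%R]) (x `^ a / x)%:E = ((1 - e `^ a) / a)%:E)%E.
Proof.
move=> a0 e0 e1.
have dF x : 0 < x -> is_derive x 1 (fun x => a^-1 *: x `^ a) (x `^ a / x).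
  move=> x0; have H := is_derive_powR_div a x0.
  have -> : x `^ a / x = a^-1 *: (a * (x `^ a / x)).
    by rewrite scalerA mulVf ?gt_eqF// scale1r.
  exact: is_deriveZ.
have cF x : 0 < x -> {for x, continuous (fun x => a^-1 *: x `^ a)}.
  move=> x0; apply: differentiable_continuous; apply/derivable1_diffP.
  by have [] := dF x x0.
rewrite (@continuous_FTC2 _ (fun x => x `^ a / x) (fun x => a^-1 *: x `^ a)) //.
- by rewrite -EFinB powR1 -scalerBr [_ *: _]mulrC.
- apply: continuous_in_subspaceT => x /[!inE]/=; rewrite in_itv/= => /andP[ex _].
  have x0 := lt_le_trans e0 ex.
  apply: cvgM; last by apply: cvgV => //; rewrite gt_eqF.
  have /derivable1_diffP/differentiable_continuous// : derivable (fun y : R => y `^ a) x 1.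
  by have [] := is_derive_powR_div a x0.
- split.
  + move=> x; rewrite in_itv/= => /andP[ex _].
    by have [] := dF x (lt_trans e0 ex).
  + by apply: cvg_at_right_filter; exact: cF.
  + by apply: cvg_at_left_filter; exact: cF.
- move=> x; rewrite in_itv/= => /andP[ex _]; rewrite derive1E.
  by have [_] := dF x (lt_trans e0 ex).
Qed.

(** Monotone convergence along an exhaustion of ]0, 1]: the integrals (1 - e^a) / a over [e, 1] stay
    below 1 / a. *)
Lemma integrable_powR_div a : 0 < a ->
  mu.-integrable `[0, 1] (EFin \o (fun x => x `^ a / x)).
Proof.
move=> a0; apply/integrableP; split.
  by apply/measurable_EFinP; exact: measurable_powR_div.
have k0 x : 0 <= x -> 0 <= x `^ a / x by move=> x0; rewrite divr_ge0 ?powR_ge0.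
under eq_integral => x.
  rewrite inE/= in_itv/= => /andP[x0 _].
  rewrite ger0_norm ?k0//; over.
rewrite -integral_itv_obnd_cbnd; last first.
  apply/measurable_EFinP; apply: measurable_funS (measurable_powR_div a) => //.
  by apply: subset_itv; rewrite bnd_simp.
(* The shift by 2 keeps the left endpoint strictly below 1, as [powR_div_itvE] requires. *)
pose F n : set R := `[n.+2%:R^-1, 1]%classic.
have F01 n : F n `<=` `[0, 1].
  by apply: subset_itv; rewrite bnd_simp// invr_ge0.
have UF : `]0, 1]%classic = \bigcup_n F n.
  apply/seteqP; split => x /=.
    rewrite in_itv/= => /andP[x0 x1].
    have [k] := ltr_add_invr x0; rewrite add0r => kx.
    exists k => //; rewrite /F/= in_itv/= x1 andbT (le_trans _ (ltW kx))//.
    by rewrite lef_pV2 ?posrE// ler_nat.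
  move=> [n _]; rewrite /F/= !in_itv/= => /andP[nx ->]; rewrite andbT.
  by apply: lt_le_trans nx; rewrite invr_gt0.
rewrite UF.
have cv : (\int[mu]_(x in F i) (x `^ a / x)%:E @[i --> \oo] -->
    \int[mu]_(x in \bigcup_i F i) (x `^ a / x)%:E)%E.
  apply: ge0_nondecreasing_set_cvg_integral => [n m nm|i|i|i x /F01].
  - apply/subsetPset; apply: subset_itv; rewrite bnd_simp//.
    by rewrite lef_pV2 ?posrE// ler_nat.
  - exact: measurable_itv.
  - by apply/measurable_EFinP; apply: measurable_funS (measurable_powR_div a).
  - by rewrite /= in_itv/= => /andP[x0 _]; rewrite lee_fin k0.
apply: (@le_lt_trans _ _ (a^-1)%:E); last by rewrite ltry.
rewrite -(cvg_lim _ cv)//; apply: lime_le; first by apply/cvg_ex; eexists; exact: cv.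
apply: nearW => n; rewrite /F powR_div_itvE ?invr_gt0 ?invf_lt1 ?ltr1n//.
rewrite lee_fin ler_pdivrMr// mulVf ?gt_eqF//.
Qed.

End JacobiKernel.

(** * Monic orthogonal polynomials for an abstract linear functional *)

Section OrthogonalPolynomials.
Variables (F : fieldType) (L : {poly F} -> F) (P : nat -> {poly F}).
Hypothesis L_linear : forall c p q, L (c *: p + q) = c * L p + L q.
Hypothesis P_monic : forall n, P n \is monic.
Hypothesis P_size : forall n, size (P n) = n.+1.
Hypothesis P_orth : forall m n, m != n -> L (P m * P n) = 0.
Local Notation h n := (L (P n ^+ 2)).
Implicit Types p q : {poly F}.

Lemma functionalD p q : L (p + q) = L p + L q.
Proof. by rewrite -[p]scale1r L_linear mul1r scale1r. Qed.

Lemma functional0 : L 0 = 0.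
Proof. by apply: (addrI (L 0)); rewrite -functionalD !addr0. Qed.

Lemma functionalZ c p : L (c *: p) = c * L p.
Proof. by rewrite -[c *: p]addr0 L_linear functional0 addr0. Qed.

Lemma functionalMC c p : L (c%:P * p) = c * L p.
Proof. by rewrite mul_polyC functionalZ. Qed.

Lemma functionalB p q : L (p - q) = L p - L q.
Proof. by rewrite functionalD -scaleN1r functionalZ mulN1r. Qed.

Lemma coef_monic_lead n : (P n)`_n = 1.
Proof. by have /monicP := P_monic n; rewrite lead_coefE P_size. Qed.

Lemma size_sub_lead n q : (size q <= n.+1)%N -> (size (q - q`_n *: P n)%R <= n)%N.
Proof.
move=> sq; apply/leq_sizeP => j; rewrite coefB coefZ leq_eqVlt => /predU1P[<-|nj].
  by rewrite coef_monic_lead mulr1 subrr.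
have -> : q`_j = 0 by rewrite nth_default// (leq_trans sq).
by rewrite (nth_default _ (_ : size (P n) <= j)%N) ?P_size// mulr0 subrr.
Qed.

Lemma orth_low n q : (size q <= n)%N -> L (P n * q) = 0.
Proof.
(* Separating the size bound [k] from [n] lets the induction strip one leading term at a time
   against a fixed [P n]. *)
suff H k : (k <= n)%N -> forall q, (size q <= k)%N -> L (P n * q) = 0 by exact: H.
elim: k => [_ {}q|k IH kn {}q sq].
  by rewrite leqn0 size_poly_eq0 => /eqP->; rewrite mulr0 functional0.
rewrite -[q](subrK (q`_k *: P k)) mulrDr functionalD IH ?(ltnW kn) ?size_sub_lead//.
by rewrite -scalerAr functionalZ P_orth ?mulr0 ?addr0// neq_ltn kn orbT.
Qed.

Lemma orthE n q : (size q <= n.+1)%N -> L (P n * q) = q`_n * h n.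
Proof.
move=> sq; rewrite -[q in LHS](subrK (q`_n *: P n)) mulrDr functionalD.
by rewrite orth_low ?size_sub_lead// add0r -scalerAr functionalZ.
Qed.

Hypothesis h_neq0 : forall n, h n != 0.

(** A nonzero [q] paired with the [P k] of its own degree would give its leading coefficient times
    [h k], which is nonzero. *)
Lemma orth_eq0 q n : (size q <= n)%N -> (forall k, (k < n)%N -> L (P k * q) = 0) -> q = 0.
Proof.
move=> sq H; apply/eqP/contraT => q0.
have /H/eqP : ((size q).-1 < n)%N by rewrite prednK ?size_poly_gt0.
rewrite orthE ?leqSpred// -lead_coefE mulf_eq0 lead_coef_eq0 (negbTE q0)/=.
by rewrite (negbTE (h_neq0 _)).
Qed.

Lemma size_MX p n : (size p <= n)%N -> (size (p * 'X)%R <= n.+1)%N.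
Proof. by move=> sp; rewrite (leq_trans (size_polyMleq _ _))// size_polyX addn2. Qed.

Lemma orth_mulX_succ n : L (P n * P n.+1 * 'X) = h n.+1.
Proof.
rewrite mulrAC mulrC orthE ?size_MX ?P_size//.
by rewrite coefMX/= coef_monic_lead mul1r.
Qed.

Lemma orth_mulX_far k n : (k < n)%N -> L (P k * P n.+1 * 'X) = 0.
Proof.
by move=> kn; rewrite mulrAC mulrC orth_low ?size_MX// P_size.
Qed.

Lemma three_term0 : P 0%N * 'X = P 1%N + (L (P 0%N ^+ 2 * 'X) / h 0%N) *: P 0%N.
Proof.
apply/subr0_eq/(@orth_eq0 _ 1); last first.
  case=> // _; rewrite opprD addrA !mulrBr -scalerAr !functionalB functionalZ.
  by rewrite P_orth// subr0 mulrA -expr2 divfK// subrr.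
apply/leq_sizeP => j; rewrite !coefB coefD coefMX coefZ; case: j => // j _ /=.
case: j => [|j].
  rewrite !coef_monic_lead (nth_default _ (_ : (size (P 0%N) <= 1)%N)) ?P_size//.
  by rewrite mulr0 addr0 subrr.
by rewrite !nth_default ?P_size// mulr0 addr0 subrr.
Qed.

(** The top coefficients cancel in the difference of the two sides, which is orthogonal to every
    [P k] with [k < n.+2]; hence it vanishes by [orth_eq0]. *)
Lemma three_term n : P n.+1 * 'X =
  P n.+2 + (L (P n.+1 ^+ 2 * 'X) / h n.+1) *: P n.+1 + (h n.+1 / h n) *: P n.
Proof.
apply/subr0_eq/(@orth_eq0 _ n.+2).
  apply/leq_sizeP => j jn; rewrite coefB !coefD coefMX !coefZ.
  case: j jn => // j jn /=.
  rewrite (nth_default _ (_ : (size (P n.+1) <= j.+1)%N)) ?P_size//.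
  rewrite (nth_default _ (_ : (size (P n) <= j.+1)%N)) ?P_size// 1?ltnW// !mulr0 !addr0.
  move: jn; rewrite ltnS leq_eqVlt => /predU1P[<-|jn].
    by rewrite !coef_monic_lead subrr.
  by rewrite !nth_default ?P_size ?subrr.
move=> k kn; rewrite mulrBr !mulrDr -!scalerAr functionalB !functionalD !functionalZ mulrA.
rewrite P_orth ?(ltn_eqF kn)// add0r.
move: kn; rewrite ltnS leq_eqVlt => /predU1P[->|].
  by rewrite -!expr2 divfK// (@P_orth n.+1 n) ?neq_ltn ?ltnSn ?orbT// mulr0 addr0 subrr.
move=> kn; rewrite (@P_orth k n.+1) ?ltn_eqF// mulr0 add0r.
move: kn; rewrite ltnS leq_eqVlt => /predU1P[->|kn].
  by rewrite orth_mulX_succ -expr2 divfK// subrr.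
by rewrite orth_mulX_far// (@P_orth k n) ?ltn_eqF// mulr0 subrr.
Qed.

(* If [T ((X - c) q) = s L q], then [T] acts on [P n q] through [q.[c]] alone,
   up to a single multiple of [h n]. *)
Lemma evaluation_identity (T : {poly F} -> F) (c s : F) :
  (forall d p q, T (d *: p + q) = d * T p + T q) ->
  (forall q, T (q * ('X - c%:P)) = s * L q) ->
  forall n, T (P n.+1 * P n) * (T (P n.+1 * P n) - s * h n) =
    T (P n.+1 ^+ 2) * T (P n ^+ 2).
Proof.
move=> T_lin Ts n.
(* Division of [q] by ['X - c%:P] leaves the remainder [q.[c]]; the quotient is short enough to pair
   with [P m] through its top coefficient alone. *)
have key p q m : (size q <= m.+2)%N -> p = P m ->
    T (p * q) = q.[c] * T p + s * (q`_m.+1 * h m).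
  move=> sq ->.
  have /factor_theorem[q1 q1E] : root (q - q.[c]%:P) c by rewrite rootE !hornerE subrr.
  have qE : q = q.[c]%:P + q1 * ('X - c%:P) by rewrite -q1E addrC subrK.
  have sq1 : (size q1 <= m.+1)%N.
    have [->|q10] := eqVneq q1 0; first by rewrite size_poly0.
    have : (size (q1 * ('X - c%:P))%R <= m.+2)%N.
      rewrite -q1E (leq_trans (size_polyD _ _))// geq_max sq size_polyN.
      by rewrite (leq_trans (size_polyC_leq1 _)).
    by rewrite size_Mmonic ?monicXsubC// size_XsubC addn2.
  have -> : P m * q = q.[c] *: P m + P m * q1 * ('X - c%:P).
    by rewrite [in LHS]qE -mul_polyC; ring.
  rewrite T_lin Ts orthE//; congr (_ + _ * (_ * _)).
  rewrite [in RHS]qE coefD coefC/= add0r mulrBr coefB coefMX/= coefMC.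
  by rewrite (nth_default _ sq1) mul0r subr0.
(* The same value is computed twice, with either factor in the role of [P m]; only the second choice
   produces the correction [s * h n]. Multiplying both regroups into the squares of [e3]. *)
have e1 : T (P n.+1 * P n) = (P n).[c] * T (P n.+1).
  rewrite (key _ _ n.+1)// ?nth_default ?P_size// ?mul0r ?mulr0 ?addr0//.
  by rewrite 1?ltnW// 1?ltnW.
have e2 : T (P n.+1 * P n) = (P n.+1).[c] * T (P n) + s * h n.
  by rewrite mulrC (key _ _ n)// ?P_size// coef_monic_lead mul1r.
have e3 m : T (P m ^+ 2) = (P m).[c] * T (P m).
  by rewrite expr2 (key _ _ m)// ?nth_default ?P_size// mul0r mulr0 addr0.
by rewrite [in X in _ * X]e2 e1 !e3; ring.
Qed.

End OrthogonalPolynomials.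

(** * Algebraic derivation of both difference equations from the Pearson identity *)

Section DifferenceEquations.
Variables (F : fieldType) (a b l : F) (M : {poly F} -> F) (P : nat -> {poly F}).
Hypothesis M_linear : forall c p q, M (c *: p + q) = c * M p + M q.
Hypothesis M_pearson : forall q,
  M (q^`() * (1 - 'X) * 'X - q * 'X
     + q * (a%:P * (1 - 'X) - b%:P * 'X - l%:P * (1 - 'X) * 'X)) = 0.
Hypothesis P_monic : forall n, P n \is monic.
Hypothesis P_size : forall n, size (P n) = n.+1.
Let L p := M (p * 'X).
Hypothesis P_orth : forall m n, m != n -> L (P m * P n) = 0.
Local Notation h n := (L (P n ^+ 2)).
Hypothesis h_neq0 : forall n, h n != 0.
Implicit Types p q : {poly F}.

Let L_linear c p q : L (c *: p + q) = c * L p + L q.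
Proof. by rewrite /L mulrDl -scalerAl M_linear. Qed.

Let LD := functionalD L_linear.
Let LB := functionalB L_linear.
Let LMC := functionalMC L_linear.
Let MD := functionalD M_linear.
Let MB := functionalB M_linear.
Let MMC := functionalMC M_linear.

(** Every term of [M_pearson] except [a * M q] carries a factor ['X], so it can be read through [L],
    where orthogonality is available. *)
Lemma L_pearson q :
  L (q^`() * (1 - 'X)) + a * M q = (1 + a + b + l) * L q - l * L (q * 'X).
Proof.
have := M_pearson q.
have -> : q^`() * (1 - 'X) * 'X - q * 'X
     + q * (a%:P * (1 - 'X) - b%:P * 'X - l%:P * (1 - 'X) * 'X) =
  q^`() * (1 - 'X) * 'X + a%:P * q + l%:P * (q * 'X * 'X) - q * 'X
   - a%:P * (q * 'X) - b%:P * (q * 'X) - l%:P * (q * 'X) by ring.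
rewrite !(MB, MD, MMC) -/(L _) -/(L q) -/(L (q * 'X)) => H.
by apply/eqP; rewrite -subr_eq0 -H; apply/eqP; ring.
Qed.

Lemma size_deriv_P n : (size (P n)^`()%R <= n)%N.
Proof. by rewrite -ltnS -[X in (_ < X)%N]P_size lt_size_deriv// monic_neq0. Qed.

Lemma L_P_derivMX n : L (P n * ((P n)^`() * 'X)) = n%:R * h n.
Proof.
rewrite (orthE L_linear)// ?size_MX ?size_deriv_P// coefMX coef_deriv.
by case: n => [|n] /=; rewrite ?mul0r// coef_monic_lead.
Qed.

Lemma L_P_deriv_next n : L (P n * (P n.+1)^`()) = n.+1%:R * h n.
Proof. by rewrite (orthE L_linear)// ?size_deriv_P// coef_deriv coef_monic_lead. Qed.

(** Subtracting [n.+1%:R *: P n.+1] kills the leading term; with p the subleading coefficient, the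
    next one becomes n p - (n + 1) p = - p. *)
Lemma L_P_derivMX_next n :
  L (P n * ((P n.+1)^`() * 'X)) = - (P n.+1)`_n * h n.
Proof.
pose d := (P n.+1)^`() * 'X - n.+1%:R *: P n.+1.
have -> : P n * ((P n.+1)^`() * 'X) = P n * d + n.+1%:R%:P * (P n * P n.+1).
  by rewrite /d -mul_polyC; ring.
rewrite LD LMC P_orth ?neq_ltn ?ltnSn// mulr0 addr0 (orthE L_linear)//.
  congr (_ * _); rewrite /d coefB coefMX coefZ coef_deriv.
  by case: n {d} => [|n] /=; ring.
have c1 : ((P n.+1)^`() * 'X)`_n.+1 = n.+1%:R.
  by rewrite coefMX/= coef_deriv coef_monic_lead.
rewrite /d -c1.
by apply: size_sub_lead => //; rewrite size_MX// size_deriv_P.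
Qed.

Lemma L_P_low n q : (size q <= n)%N -> L (P n * q) = 0.
Proof. exact: (orth_low L_linear). Qed.

Lemma pearson_P2 n :
  a * M (P n ^+ 2) = (2 * n%:R + 1 + a + b + l) * h n - l * L (P n ^+ 2 * 'X).
Proof.
have := L_pearson (P n ^+ 2).
have -> : (P n ^+ 2)^`() * (1 - 'X) =
    P n * (P n)^`() + P n * (P n)^`() - (P n * ((P n)^`() * 'X) + P n * ((P n)^`() * 'X)).
  by rewrite expr2 derivM; ring.
rewrite LB !LD L_P_derivMX L_P_low ?size_deriv_P//.
by rewrite addr0 sub0r addrC => /eqP; rewrite subr_eq => /eqP ->; ring.
Qed.

(** The Pearson identity for [q = P n.+1 * P n]; it serves to eliminate the subleading coefficient
    in [N_PP]. *)
Lemma pearson_PP n :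
  (n.+1%:R + (P n.+1)`_n) * h n + a * M (P n.+1 * P n) = - l * h n.+1.
Proof.
have := L_pearson (P n.+1 * P n).
have -> : (P n.+1 * P n)^`() * (1 - 'X) =
    P n * (P n.+1)^`() - P n * ((P n.+1)^`() * 'X) + P n.+1 * ((P n)^`() - (P n)^`() * 'X).
  by rewrite derivM; ring.
rewrite LD LB L_P_deriv_next L_P_derivMX_next (P_orth (m := n.+1)) ?neq_ltn ?ltnSn ?orbT//.
rewrite [X in L (X * 'X)]mulrC (orth_mulX_succ L_linear)// L_P_low; last first.
  rewrite (leq_trans (size_polyD _ _))// geq_max size_polyN size_MX ?size_deriv_P//.
  by rewrite andbT (leq_trans (size_deriv_P _)).
by rewrite mulr0 sub0r => H; rewrite [RHS]mulNr -H; ring.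
Qed.

(* The functional [b \int p w / (1 - x)], written without the integral by means
   of the Pearson identity. *)
Let N p := L (p^`() * 'X) + (1 + a + b) * L p - l * L (p * 'X).

Let N_linear c p q : N (c *: p + q) = c * N p + N q.
Proof.
rewrite /N derivD derivZ !mulrDl -!scalerAl !L_linear; ring.
Qed.

(** The hypothesis of [evaluation_identity] at the endpoint 1, with [s = - b]; it comes from the
    Pearson identity for [q * 'X]. *)
Let N_XsubC q : N (q * ('X - 1%:P)) = - b * L q.
Proof.
have := L_pearson (q * 'X).
rewrite /N !derivM derivB derivX derivC.
rewrite -/(L q).
have -> : (q^`() * 'X + q * 1) * (1 - 'X) =
  q^`() * 'X + q - q^`() * 'X * 'X - q * 'X by ring.
have -> : (q^`() * ('X - 1%:P) + q * (1 - 0)) * 'X =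
  q^`() * 'X * 'X - q^`() * 'X + q * 'X by ring.
have -> : q * ('X - 1%:P) = q * 'X - q by ring.
rewrite mulrBl !(LB, LD) => H.
apply/eqP; rewrite -subr_eq0; apply/eqP.
transitivity ((1 + a + b + l) * L (q * 'X) - l * L (q * 'X * 'X) -
  (L (q^`() * 'X) + L q - L (q^`() * 'X * 'X) - L (q * 'X) + a * L q)); first by ring.
by rewrite -H subrr.
Qed.

(** Phrased to match [evaluation_identity] at the endpoint 0, with [s = 1]. *)
Let M_XsubC q : M (q * ('X - 0%:P)) = 1 * L q.
Proof. by rewrite subr0 mul1r. Qed.

(** In terms of [Rn] this value is [h n * (Rn n - l)], the source of the shift by [l] at the
    endpoint 1. *)
Lemma N_P2 n : N (P n ^+ 2) = a * M (P n ^+ 2) - l * h n.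
Proof.
rewrite /N expr2 derivM mulrDl -[_ * P n * 'X]mulrA [_ * (P n * _)]mulrCA -mulrA.
rewrite LD L_P_derivMX -expr2 pearson_P2; ring.
Qed.

Lemma N_PP n : N (P n.+1 * P n) = n.+1%:R * h n + a * M (P n.+1 * P n).
Proof.
have H := pearson_PP n.
rewrite /N derivM.
have -> : ((P n.+1)^`() * P n + P n.+1 * (P n)^`()) * 'X =
  P n * ((P n.+1)^`() * 'X) + P n.+1 * ((P n)^`() * 'X) by ring.
rewrite LD L_P_derivMX_next L_P_low ?size_MX ?size_deriv_P//.
rewrite (P_orth (m := n.+1)) ?neq_ltn ?ltnSn ?orbT//.
rewrite [X in L (X * 'X)]mulrC (orth_mulX_succ L_linear)//.
by rewrite mulr0 !addr0 -mulNr -H; ring.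
Qed.

Let Rn n := a / h n * M (P n ^+ 2).
Let rn n := if n is m.+1 then a / h m * M (P m.+1 * P m) else 0.
Hypothesis a_neq0 : a != 0.
Hypothesis MP2_neq0 : forall n, M (P n ^+ 2) != 0.

Lemma difference_eq1 n :
  l * (rn n.+1 + rn n) = Rn n ^+ 2 - Rn n * (2 * n%:R + 1 + a + b + l) + l * a.
Proof.
have hn := h_neq0 n.
have E1 := pearson_P2 n.
(* The [else 0] branch replaces the missing P_{-1} term of the recurrence and agrees with the
   convention r_0 = 0. *)
have three : h n = M (P n.+1 * P n) + L (P n ^+ 2 * 'X) / h n * M (P n ^+ 2)
    + (if n is m.+1 then h n / h m * M (P m.+1 * P m) else 0).
  transitivity (M (P n * (P n * 'X))); first by rewrite mulrA -expr2.
  case: n {hn E1} => [|m].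
    have := three_term0 L_linear P_monic P_size P_orth h_neq0.
    move: (L (P 0%N ^+ 2 * 'X) / h 0%N) => c ->.
    rewrite mulrDr -scalerAr MD (functionalZ M_linear).
    by rewrite addr0 [P 1%N * _]mulrC -expr2.
  have := @three_term _ _ _ L_linear P_monic P_size P_orth h_neq0 m.
  move: (L (P m.+1 ^+ 2 * 'X) / h m.+1) (h m.+1 / h m) => c d ->.
  rewrite !mulrDr -!scalerAr !MD !(functionalZ M_linear).
  by rewrite [P m.+1 * P m.+2]mulrC -expr2.
have {}three : rn n.+1 + rn n = a - L (P n ^+ 2 * 'X) / h n * Rn n.
  rewrite /rn /Rn; case: n hn three {E1} => [|n] hn three.
    rewrite addr0; have -> : M (P 1 * P 0) = h 0 - L (P 0 ^+ 2 * 'X) / h 0 * M (P 0 ^+ 2).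
      by rewrite [X in X - _]three; ring.
    by field.
  have hn' := h_neq0 n.
  have -> : M (P n.+2 * P n.+1) = h n.+1 - L (P n.+1 ^+ 2 * 'X) / h n.+1 * M (P n.+1 ^+ 2)
     - h n.+1 / h n * M (P n.+1 * P n).
    by rewrite [X in X - _ - _]three; ring.
  by field; rewrite hn hn'.
rewrite three.
(* The product [l * L (P n ^+ 2 * 'X)] is kept whole so that [E1] replaces it without division by
   [l], which may be zero. *)
have -> : l * (a - L (P n ^+ 2 * 'X) / h n * Rn n) =
    l * a - (l * L (P n ^+ 2 * 'X)) / h n * Rn n.
  by ring.
have -> : l * L (P n ^+ 2 * 'X) = (2 * n%:R + 1 + a + b + l) * h n - a * M (P n ^+ 2).
  by rewrite E1; ring.
by rewrite /Rn; field.
Qed.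

Lemma difference_eq2 n :
  n.+1%:R * (n.+1%:R + b) + (2 * n.+1%:R + a + b) * rn n.+1 =
  (rn n.+1 ^+ 2 - a * rn n.+1) * (l ^+ 2 / (Rn n.+1 * Rn n) - l / Rn n.+1 - l / Rn n).
Proof.
have evM := evaluation_identity L_linear P_monic P_size P_orth M_linear M_XsubC n.
have evN := evaluation_identity L_linear P_monic P_size P_orth N_linear N_XsubC n.
rewrite !N_P2 !N_PP in evN.
rewrite /rn /Rn; move: (h_neq0 n) (h_neq0 n.+1) (MP2_neq0 n) (MP2_neq0 n.+1) evM evN.
move: (h n) (h n.+1) (M (P n ^+ 2)) (M (P n.+1 ^+ 2)) (M (P n.+1 * P n)) => h0 h1 m0 m1 m.
move=> h0n h1n m0n m1n evM evN.
rewrite mul1r in evM.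
(* The endpoint 0 identity exposes a multiple of [Rn n.+1 * Rn n], which clears the denominators on
   the right. *)
have -> : (a / h0 * m) ^+ 2 - a * (a / h0 * m) = a ^+ 2 * (m1 * m0) / h0 ^+ 2.
  by rewrite -evM; field.
transitivity ((l ^+ 2 * h1 * h0 - l * a * (m1 * h0 + m0 * h1)) / h0 ^+ 2); last first.
  by field; rewrite h0n h1n m0n m1n a_neq0.
(* The right side becomes the difference of the identities at the endpoints 1 and 0. *)
have -> : l ^+ 2 * h1 * h0 - l * a * (m1 * h0 + m0 * h1) =
   (a * m1 - l * h1) * (a * m0 - l * h0) - a ^+ 2 * (m1 * m0) by ring.
by rewrite -evN -evM; field.
Qed.

End DifferenceEquations.

(** * Endpoint behaviour, derivative and integrability of the weight *)

Section Weight.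
Local Open Scope classical_set_scope.
Variables (R : realType) (a b l : R).
Hypotheses (a0 : 0 < a) (b0 : 0 < b).
Notation mu := (@lebesgue_measure R).
Notation w := (weight a b l).
Implicit Types (x : R) (p q : {poly R}).

Lemma is_derive_mul (f g : R -> R) x (df dg : R) :
  is_derive x 1 f df -> is_derive x 1 g dg ->
  is_derive x 1 (fun y => f y * g y) (df * g x + f x * dg).
Proof.
move=> Hf Hg; apply: is_derive_eq (is_deriveM Hf Hg) _.
by rewrite addrC [_ *: _]mulrC.
Qed.

Lemma derivable_cvg (f : R -> R) x (df : R) :
  is_derive x 1 f df -> f y @[y --> x] --> f x.
Proof. by move=> [] /derivable1_diffP/differentiable_continuous. Qed.

Lemma is_derive_onem_powR x : x < 1 ->
  is_derive x 1 (fun y : R => (1 - y) `^ b) (- (b * ((1 - x) `^ b / (1 - x)))).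
Proof.
move=> x1; have x1' : 0 < 1 - x by rewrite subr_gt0.
have H : is_derive x 1 (fun y : R => 1 - y) (-1).
  apply: is_derive_eq. by rewrite add0r mul1r.
have -> : - (b * ((1 - x) `^ b / (1 - x))) = (b * ((1 - x) `^ b / (1 - x))) * -1.
  by rewrite mulrN1.
exact: (@is_derive1_comp R (fun y => y `^ b) (fun y => 1 - y) x _ _
  (is_derive_powR_div b x1') H).
Qed.

Lemma is_derive_expRN x :
  is_derive x 1 (fun y : R => expR (- (l * y))) (- (l * expR (- (l * x)))).
Proof.
have H : is_derive x 1 (fun y : R => - (l * y)) (- l).
  by apply: is_derive_eq; rewrite [_ *: _]mulr1.
have -> : - (l * expR (- (l * x))) = expR (- (l * x)) * - l by rewrite mulrN mulrC.
exact: (@is_derive1_comp R expR (fun y => - (l * y)) x _ _ (is_derive_expR _) H).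
Qed.

Lemma weight0 : w 0 = 0.
Proof. by rewrite /weight powR0 ?mul0r // gt_eqF. Qed.

Lemma weight1 : w 1 = 0.
Proof. by rewrite /weight subrr powR0 ?mulr0 ?mul0r // gt_eqF. Qed.

Lemma weight_ge0 x : 0 <= w x.
Proof. by rewrite /weight !mulr_ge0 ?powR_ge0 ?expR_ge0. Qed.

Lemma weight_gt0 x : 0 < x -> x < 1 -> 0 < w x.
Proof.
by move=> x0 x1; rewrite /weight !mulr_gt0 ?powR_gt0 ?expR_gt0 ?subr_gt0.
Qed.

(** Isolates the dependence on [l], in preparation for expanding the exponential. *)
Lemma weightE x : w x = expR (- (l * x)) * weight a b 0 x.
Proof. by rewrite /weight mul0r oppr0 expR0 mulr1 mulrC. Qed.

Lemma is_derive_weight x : 0 < x -> x < 1 ->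
  is_derive x 1 w (w x * (a / x - b / (1 - x) - l)).
Proof.
move=> x0 x1.
have H := is_derive_mul (is_derive_mul (is_derive_powR_div a x0)
  (is_derive_onem_powR x1)) (is_derive_expRN x).
apply: is_derive_eq H _; rewrite /weight.
by field; rewrite subr_eq0 !gt_eqF.
Qed.

Lemma weight_cvg0 : w x @[x --> 0^'+] --> 0.
Proof.
rewrite [X in _ --> X](_ : _ = 0 * (1 - 0 : R) `^ b * expR (- (l * 0))); last first.
  by rewrite !mul0r.
apply: cvgM; first apply: cvgM.
- exact: powR_cvg0.
- by apply: cvg_at_right_filter; apply: derivable_cvg (is_derive_onem_powR _).
- by apply: cvg_at_right_filter; apply: derivable_cvg (is_derive_expRN _).
Qed.

Lemma weight_cvg1 : w x @[x --> 1^'-] --> 0.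
Proof.
rewrite [X in _ --> X](_ : _ = (1 : R) `^ a * 0 * expR (- (l * 1))); last first.
  by rewrite mulr0 mul0r.
apply: cvgM; first apply: cvgM.
- by apply: cvg_at_left_filter; apply: derivable_cvg (is_derive_powR_div _ _).
(* The reflection 1 - y turns the left limit at 1 into the right limit of y^b at 0. *)
- apply: (@decreasing_cvg_at_left_comp R (fun y => 1 - y) (fun y => y `^ b) -oo%O 1) => //.
  + by move=> y z _ _ yz; rewrite ltrD2l ltrN2.
  + by apply: cvg_at_left_filter; apply: cvgB; [exact: cvg_cst|exact: cvg_id].
  + by rewrite subrr; exact: powR_cvg0.
- by apply: cvg_at_left_filter; apply: derivable_cvg (is_derive_expRN _).
Qed.

Lemma horner_bounded01 p :
  exists2 K : R, 0 <= K & forall x, 0 <= x -> x <= 1 -> `|p.[x]| <= K.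
Proof.
elim/poly_ind: p => [|p c [K K0 IH]]; first by exists 0 => // x _ _; rewrite horner0 normr0.
exists (K + `|c|) => [|x x0 x1]; first by rewrite addr_ge0.
rewrite !hornerE (le_trans (ler_normD _ _))// lerD2r normrM (ger0_norm x0).
by rewrite (le_trans _ (IH x x0 x1))// ler_piMr.
Qed.

(** Reduces integrability to the kernel x^a / x: on [0, 1] the power of 1 - x is at most 1 and the
    exponent is at most [|l|] in absolute value. *)
Lemma weight_le x : 0 <= x -> x <= 1 -> w x <= expR `|l| * x `^ a.
Proof.
move=> x0 x1; rewrite /weight mulrAC [leRHS]mulrC.
have h1 : (1 - x) `^ b <= 1.
  have e1 : (1 : R) `^ b = 1 by rewrite powR1.
  rewrite -[leRHS]e1 ge0_ler_powR ?nnegrE ?(ltW b0) ?subr_ge0 //.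
  by rewrite lerBlDr lerDl.
have h2 : expR (- (l * x)) <= expR `|l|.
  rewrite ler_expR (le_trans (ler_norm _))// normrN normrM (ger0_norm x0).
  by rewrite ler_piMr.
rewrite -[leRHS]mulr1 ler_pM ?mulr_ge0 ?powR_ge0 ?expR_ge0 //.
by rewrite ler_wpM2l ?powR_ge0.
Qed.

Lemma measurable_weight_div : measurable_fun (`[0, 1] : set R) (fun x => w x / x).
Proof.
apply: (@eq_measurable_fun _ _ _ _ _ (fun x =>
  (x `^ a / x) * ((1 - x) `^ b * expR (- (l * x))))).
  by move=> x _; rewrite /weight; ring.
apply: measurable_funM; first exact: measurable_powR_div.
apply: measurable_funM.
  apply: measurable_funTS.
  apply: (@measurableT_comp _ _ _ _ _ _ (fun x : R => x `^ b)).
    exact: measurable_powR.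
  by apply: measurable_funB.
apply: measurable_funTS; apply: measurableT_comp; first exact: measurable_expR.
by apply: measurable_funN; apply: measurable_funM.
Qed.

Lemma measurable_horner p (D : set R) : measurable_fun D (horner p).
Proof.
by apply/measurable_funTS; apply: continuous_measurable_fun; exact/continuous_horner.
Qed.

Lemma integrable_horner_weight p :
  mu.-integrable `[0, 1] (EFin \o (fun x => p.[x] * (w x / x))).
Proof.
have [K K0 Kp] := horner_bounded01 p.
have : mu.-integrable `[0, 1] (fun x : R => ((K * expR `|l|)%:E * (x `^ a / x)%:E)%E).
  by apply: integrableZl => //; exact: integrable_powR_div a0.
apply: le_integrable => //.
  apply/measurable_EFinP; apply: measurable_funM; first exact: measurable_horner.
  exact: measurable_weight_div.
move=> x /=; rewrite in_itv/= => /andP[x0 x1].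
have h : 0 <= w x / x by rewrite divr_ge0 ?weight_ge0.
rewrite lee_fin normrM (ger0_norm h) [leRHS]ger0_norm; last first.
  by rewrite !mulr_ge0 ?expR_ge0 ?powR_ge0 ?invr_ge0.
rewrite -[leRHS]mulrA ler_pM ?Kp //.
by rewrite mulrA ler_wpM2r ?invr_ge0 ?weight_le.
Qed.

End Weight.

(** * The moment functional of w(x) / x: linearity, Pearson identity, positivity *)

Definition moment (R : realType) (a b l : R) (p : {poly R}) : R :=
  int01 (fun x => p.[x] * (weight a b l x / x)).

Section Moment.
Local Open Scope classical_set_scope.
Variables (R : realType) (a b l : R).
Hypotheses (a0 : 0 < a) (b0 : 0 < b).
Notation mu := (@lebesgue_measure R).
Notation w := (weight a b l).
Notation M := (moment a b l).
Implicit Types (x c : R) (p q : {poly R}).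

Lemma moment_linear c p q : M (c *: p + q) = c * M p + M q.
Proof.
rewrite /moment /int01 -RintegralZl//; last exact: integrable_horner_weight.
rewrite -RintegralD//; last 2 first.
- apply: eq_integrable (integrable_horner_weight l a0 b0 (c *: p)) => //.
  by move=> x _ /=; rewrite hornerZ -mulrA.
- exact: integrable_horner_weight.
by apply: eq_Rintegral => x _; rewrite hornerD hornerZ; ring.
Qed.

Lemma moment_sum (c : nat -> R) (q : nat -> {poly R}) (n : nat) :
  M (\sum_(0 <= k < n) c k *: q k) = \sum_(0 <= k < n) c k * M (q k).
Proof.
elim: n => [|n IH]; first by rewrite !big_geq// (functional0 moment_linear).
by rewrite !big_nat_recr//= addrC moment_linear IH addrC.
Qed.

Lemma int01_weight p : int01 (fun x => p.[x] * w x) = M (p * 'X).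
Proof.
apply: eq_Rintegral => x _; rewrite hornerMX -mulrA; congr (_ * _).
(* At 0, where division returns 0, both sides vanish because the weight does. *)
have [->|x0] := eqVneq x 0; first by rewrite weight0// mul0r.
by rewrite mulrC divfK.
Qed.

Lemma EFin_moment (p : {poly R}) :
  (\int[mu]_(x in `[0%R, 1%R]) (p.[x] * (w x / x))%:E = (M p)%:E)%E.
Proof.
rewrite /moment /int01 /Rintegral fineK//.
by apply: integrable_fin_num => //; exact: integrable_horner_weight.
Qed.

Lemma weight_div_continuous x : 0 < x -> x < 1 -> w y / y @[y --> x] --> w x / x.
Proof.
move=> x0 x1; apply: cvgM; first exact: derivable_cvg (is_derive_weight _ _ _ x0 x1).
by apply: cvgV; [rewrite gt_eqF|exact: cvg_id].
Qed.

(** The integrand is the derivative of q (1 - x) w, which vanishes at both endpoints. The factor 1 -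
    x cancels the singularity of w' at 1; the one at 0 remains and calls for
    [Rintegral_FTC2_left]. *)
Lemma moment_pearson q :
  M (q^`() * (1 - 'X) * 'X - q * 'X
     + q * (a%:P * (1 - 'X) - b%:P * 'X - l%:P * (1 - 'X) * 'X)) = 0.
Proof.
set G := (X in M X).
rewrite /moment /int01.
pose F x := q.[x] * (1 - x) * w x.
have F0 : F 0 = 0 by rewrite /F weight0// mulr0.
have F1 : F 1 = 0 by rewrite /F weight1// mulr0.
have qc x : q.[y] * (1 - y) @[y --> x] --> q.[x] * (1 - x).
  apply: cvgM; first exact: continuous_horner.
  by apply: cvgB; [exact: cvg_cst|exact: cvg_id].
transitivity (F 1 - F 0); last by rewrite F0 F1 subr0.
apply: Rintegral_FTC2_left => //; rewrite ?F0 ?F1.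
- exact: integrable_horner_weight.
- move=> x x0 x1; apply/continuous_within_itvP => //.
  have cf (y : R) : 0 < y -> y < 1 -> G.[z] * (w z / z) @[z --> y] --> G.[y] * (w y / y).
    move=> y0 y1; apply: cvgM; first exact: continuous_horner.
    exact: weight_div_continuous.
  split.
  + by move=> y; rewrite in_itv/= => /andP[xy y1]; apply: cf => //; exact: lt_trans xy.
  + by apply: cvg_at_right_filter; exact: cf.
  + apply: cvgM; first by apply: cvg_at_left_filter; exact: continuous_horner.
    rewrite weight1//; apply: cvgM; first exact: weight_cvg1.
    by apply: cvgV => //; apply: cvg_at_left_filter; exact: cvg_id.
- rewrite -[X in _ --> X](mulr0 (q.[0] * (1 - 0))); apply: cvgM; last exact: weight_cvg0.
  by apply: cvg_at_right_filter; exact: qc.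
- rewrite -[X in _ --> X](mulr0 (q.[1] * (1 - 1))); apply: cvgM; last exact: weight_cvg1.
  by apply: cvg_at_left_filter; exact: qc.
move=> x x0 x1.
have H1 : is_derive x 1 (fun y : R => 1 - y) (-1).
  by apply: is_derive_eq; rewrite add0r mul1r.
have := is_derive_mul (is_derive_mul (is_derive_poly q x) H1)
  (is_derive_weight a b l x0 x1).
move=> /is_derive_eq; apply.
have -> : G.[x] = q^`().[x] * (1 - x) * x - q.[x] * x
    + q.[x] * (a * (1 - x) - b * x - l * (1 - x) * x) by rewrite /G !hornerE.
by field; rewrite subr_eq0 !gt_eqF.
Qed.

(** By continuity the nonnegative integrand exceeds half its value at a non-root of [p] on a whole
    interval to the right of that point. *)
Lemma moment_sqr_gt0 p : p != 0 -> 0 < M (p ^+ 2 * 'X).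
Proof.
move=> p0.
have [x [x0 x1 px]] : exists x, [/\ 0 < x, x < 1 & p.[x] != 0].
  apply: contrapT => /forallNP nx.
  (* These are [size p] distinct points of ]0, 1[, one more than the roots a nonzero [p] can
     have. *)
  pose s := [seq (i.+2%:R^-1 : R) | i <- iota 0 (size p)].
  have us : uniq s.
    rewrite map_inj_uniq ?iota_uniq// => i j /invr_inj /eqP.
    by rewrite eqr_nat !eqSS => /eqP.
  have rs : all (root p) s.
    apply/allP => _ /mapP[i _ ->]; rewrite rootE; apply: contrapT => /negP pi.
    by apply: (nx i.+2%:R^-1); rewrite invr_gt0 ltr0n invf_lt1 ?ltr1n ?ltr0n.
  by have := max_poly_roots p0 rs us; rewrite size_map size_iota ltnn.
rewrite -int01_weight.
pose f y := (p ^+ 2).[y] * w y.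
have f0 y : 0 <= f y by rewrite mulr_ge0 ?weight_ge0// horner_exp sqr_ge0.
have fx : 0 < f x.
  by rewrite mulr_gt0 ?weight_gt0// horner_exp exprn_even_gt0.
have cf : f y @[y --> x] --> f x.
  apply: cvgM; first exact: continuous_horner.
  exact: derivable_cvg (is_derive_weight a b l x0 x1).
have : \forall y \near x, f x / 2 < f y.
  by apply: cvgr_gt cf _ _; rewrite ltr_pdivrMr// ltr_pMr// ltr1n.
move=> /nbhs_ballP[e /= e0 He].
(* Half the radius keeps ]x, z] inside the ball; the cap keeps it inside [0, 1]. *)
pose z := Num.min (x + e / 2) 1.
have xz : x < z by rewrite /z lt_min x1 andbT ltrDl divr_gt0.
have z1 : z <= 1 by rewrite /z ge_min lexx orbT.
have fz y : x < y -> y <= z -> f x / 2 <= f y.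
  move=> xy yz; apply/ltW/He; rewrite /ball/= distrC gtr0_norm ?subr_gt0//.
  have : y <= x + e / 2 by apply: le_trans yz _; rewrite /z ge_min lexx.
  by rewrite ltrBlDl => /le_lt_trans; apply; rewrite ltrD2l ltr_pdivrMr// ltr_pMr// ltr1n.
have If : mu.-integrable `[0, 1] (EFin \o f).
  apply: eq_integrable (integrable_horner_weight l a0 b0 (p ^+ 2 * 'X)) => //.
  move=> y _ /=; rewrite /f hornerMX -mulrA; congr ((_ * _)%:E).
  have [->|y0] := eqVneq y 0; first by rewrite weight0// mul0r.
  by rewrite mulrC divfK.
have Ix : mu.-integrable `]x, 1] (EFin \o f).
  by apply: integrableS If => //; apply: subset_itv; rewrite bnd_simp// ltW.
have Iz : mu.-integrable `]x, z] (EFin \o f).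
  by apply: integrableS Ix => //; apply: subset_itv; rewrite bnd_simp// ltW.
have ge0 (A : set R) : 0 <= \int[mu]_(y in A) f y by apply: Rintegral_ge0.
have E1 := @Rintegral_itvB R f (BLeft 0) (BRight 1) x If.
have E2 := @Rintegral_itvB R f (BRight x) (BRight 1) z Ix.
rewrite !bnd_simp in E1 E2.
have {}E1 := E1 (ltW x0) (ltW x1); have {}E2 := E2 (ltW xz) z1.
have lec : \int[mu]_(y in `]x, z]) (f x / 2) <= \int[mu]_(y in `]x, z]) f y.
  apply: le_Rintegral => //.
    apply: measurable_bounded_integrable => //; last exact: bounded_cst.
    by rewrite /= lebesgue_measure_itv/= lte_fin xz -EFinB ltry.
  by move=> y /=; rewrite in_itv/= => /andP[xy yz]; exact: fz.
rewrite Rintegral_cst//= lebesgue_measure_itv/= lte_fin xz -EFinB/= in lec.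
have pos : 0 < f x / 2 * (z - x) by rewrite mulr_gt0 ?divr_gt0 ?subr_gt0.
apply: (lt_le_trans pos); apply: (le_trans lec).
apply: (@le_trans _ _ (\int[mu]_(y in `]x, 1]) f y)); first by rewrite -subr_ge0 E2 ge0.
by rewrite -E1 lerBlDr lerDl ge0.
Qed.

(** Since x is at most 1 on the interval; this carries positivity over to [M (p ^+ 2)]. *)
Lemma moment_sqr_MX_le p : M (p ^+ 2 * 'X) <= M (p ^+ 2).
Proof.
apply: le_Rintegral => //; [exact: integrable_horner_weight..|].
move=> x /=; rewrite in_itv/= => /andP[x0 x1].
rewrite ler_wpM2r ?divr_ge0 ?weight_ge0// hornerMX horner_exp.
by rewrite ler_piMr ?sqr_ge0.
Qed.

End Moment.

(** * Moments as Kummer functions *)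

Section KummerFunction.
Local Open Scope classical_set_scope.
Variables (R : realType) (a b l : R).
Hypotheses (a0 : 0 < a) (b0 : 0 < b).
Notation mu := (@lebesgue_measure R).
Notation M := (moment a b).
Implicit Types (x : R) (j k n : nat).

Lemma series_exp_coeff_le x n : `|series (exp_coeff x) n| <= expR `|x|.
Proof.
apply: (@le_trans _ _ (series (exp_coeff `|x|) n)).
  rewrite /series /= (le_trans (ler_norm_sum _ _ _))// ler_sum// => i _.
  by rewrite /exp_coeff/= normrM normrX normfV normr_nat.
apply: nondecreasing_cvgn_le; last exact: is_cvg_series_exp_coeff.
by apply: nondecreasing_series => i _ _; exact: exp_coeff_ge0.
Qed.

Lemma moment_Xn_series j :
  series (fun k => ((- l) ^+ k / k`!%:R) * M 0 'X^(k + j)) @ \oo --> M l 'X^j.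
Proof.
pose q n : {poly R} := \sum_(0 <= k < n) ((- l) ^+ k / k`!%:R) *: 'X^(k + j).
have qE n x : (q n).[x] = series (exp_coeff (- (l * x))) n * x ^+ j.
  rewrite horner_sum /series/= mulr_suml; apply: eq_bigr => k _.
  by rewrite hornerZ hornerXn exprD /exp_coeff/= -mulNr exprMn; ring.
have intP c p := integrable_horner_weight c a0 b0 p.
have lim : (\int[mu]_(x in `[0%R, 1%R]) ((q n).[x] * (weight a b 0 x / x))%:E @[n --> \oo]
    --> \int[mu]_(x in `[0%R, 1%R]) ('X^j.[x] * (weight a b l x / x))%:E)%E.
  apply: (@dominated_cvg _ _ _ mu _ _ (fun n x => ((q n).[x] * (weight a b 0 x / x))%:E)
    (fun x => ('X^j.[x] * (weight a b l x / x))%:E)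
    (fun x => ((expR `|l|)%:P.[x] * (weight a b 0 x / x))%:E)) => //.
  - by move=> n; exact: measurable_int (intP 0 (q n)).
  - move=> x _; apply: cvg_EFin.
      by apply: nearW.
    rewrite [X in X @ _ --> _](_ : _ = (fun n => series (exp_coeff (- (l * x))) n *
        (x ^+ j * (weight a b 0 x / x)))); last first.
      by apply/funext => n /=; rewrite qE -mulrA.
    rewrite hornerXn (weightE a b l) [X in _ --> X](_ : _ = expR (- (l * x)) *
        (x ^+ j * (weight a b 0 x / x))); last by ring.
    apply: cvgMl; exact: is_cvg_series_exp_coeff.
  - exact: intP.
  move=> n x /=; rewrite in_itv/= => /andP[x0 x1].
  rewrite lee_fin qE hornerC.
  have v0 : 0 <= weight a b 0 x / x by rewrite divr_ge0 ?weight_ge0.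
  rewrite normrM (ger0_norm v0) ler_wpM2r// normrM -[leRHS]mulr1 ler_pM//.
    rewrite (le_trans (series_exp_coeff_le _ _))// ler_expR normrN normrM (ger0_norm x0).
    by rewrite ler_piMr.
  by rewrite normrX ger0_norm// exprn_ile1.
rewrite EFin_moment// in lim.
rewrite [X in X @ _ --> _](_ : _ = fine \o (fun n =>
    (\int[mu]_(x in `[0%R, 1%R]) ((q n).[x] * (weight a b 0 x / x))%:E)%E)).
  exact: fine_cvg lim.
by apply/funext => n /=; rewrite EFin_moment// moment_sum.
Qed.

(** At [l = 0] the Pearson identity for ['X^k] involves only two consecutive moments, which gives
    the beta recurrence without Gamma functions. *)
Lemma moment_Xn_succ k : M 0 'X^(k.+1) = (a + k%:R) / (1 + a + b + k%:R) * M 0 'X^k.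
Proof.
have ML := moment_linear 0 a0 b0.
have := moment_pearson 0 a0 b0 'X^k.
rewrite [X in M 0 X](_ : _ = (a + k%:R) *: 'X^k - (1 + a + b + k%:R) *: 'X^(k.+1)).
  rewrite (functionalB ML) !(functionalZ ML) => /subr0_eq E.
  have d0 : 0 < 1 + a + b + k%:R by rewrite ltr_pwDl// !addr_gt0.
  by rewrite mulrAC E mulrC mulKf// gt_eqF.
have -> : ('X^k)^`() * (1 - 'X) * 'X = k%:R%:P * ('X^k - 'X^(k.+1)) :> {poly R}.
  rewrite derivXn; case: k => [|k]; first by rewrite !mulr0n polyC0 !mul0r.
  rewrite /= polyC_natr -mulr_natl !exprS; ring.
rewrite -!mul_polyC !polyCD polyC1 exprS polyC0; ring.
Qed.

Lemma pochhammerS (c : R) k : pochhammer c k.+1 = pochhammer c k * (c + k%:R).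
Proof. by rewrite /pochhammer big_ord_recr. Qed.

Lemma pochhammer_gt0 (c : R) k : 0 < c -> 0 < pochhammer c k.
Proof. by move=> c0; apply: prodr_gt0 => i _; rewrite ltr_pwDl. Qed.

Lemma moment_Xn_gt0 k : 0 < M 0 'X^k.
Proof.
have d_gt0 n : 0 < (a + n%:R) / (1 + a + b + n%:R).
  by rewrite divr_gt0// ltr_wpDr// !addr_gt0.
elim: k => [|k IH]; last by rewrite moment_Xn_succ mulr_gt0.
(* [moment_sqr_gt0] always carries a factor ['X], so the moment of 1 is reached backwards from that
   of ['X]. *)
rewrite -(pmulr_rgt0 _ (d_gt0 0%N)) -moment_Xn_succ.
by rewrite -['X^1]mul1r -(expr1n _ 2) moment_sqr_gt0// oner_neq0.
Qed.

Lemma moment_XnD k j :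
  M 0 'X^(k + j) = pochhammer (a + j%:R) k / pochhammer (1 + a + b + j%:R) k * M 0 'X^j.
Proof.
elim: k => [|k IH]; first by rewrite /pochhammer !big_ord0 divr1 mul1r.
have p_gt0 : 0 < pochhammer (1 + a + b + j%:R) k.
  by rewrite pochhammer_gt0// ltr_wpDr// !addr_gt0.
have d_gt0 : 0 < 1 + a + b + j%:R + k%:R by rewrite -addrA ltr_wpDr ?addr_ge0// !addr_gt0.
rewrite addSn moment_Xn_succ IH !pochhammerS natrD.
rewrite [k%:R + j%:R]addrC !addrA.
by field; rewrite (gt_eqF p_gt0) (gt_eqF d_gt0).
Qed.

(** By [moment_XnD] the ratio of Pochhammer symbols is a ratio of moments at [l = 0], so the Kummer
    series is the expansion of [moment_Xn_series] divided by [M 0 'X^j]. *)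
Lemma moment_kummer j :
  M l 'X^j = kummer (a + j%:R) (1 + a + b + j%:R) (- l) * M 0 'X^j.
Proof.
have m0 := lt0r_neq0 (moment_Xn_gt0 j).
rewrite /kummer; set f := fun k => _.
suff -> : limn (series f) = M l 'X^j / M 0 'X^j by rewrite divfK.
apply: cvg_lim => //.
rewrite [X in X @ _ --> _](_ : _ = (fun n => series (fun k =>
    ((- l) ^+ k / k`!%:R) * M 0 'X^(k + j)) n / M 0 'X^j)).
  by apply: cvgMl; exact: moment_Xn_series.
apply/funext => n; rewrite /series/= mulr_suml; apply: eq_bigr => k _.
by rewrite moment_XnD mulrA mulfK// mulrC.
Qed.

End KummerFunction.

(** * Transfer to the weighted integrals, and the value of R_0 *)

Theorem theorem2p6 (R : realType) (alpha beta lambda : R)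
    (halpha : 0 < alpha) (hbeta : 0 < beta)
    (P : nat -> {poly R}) (hP : monic_orthogonal alpha beta lambda P) :
  let r := aux_r alpha beta lambda P in
  let Rn := aux_R alpha beta lambda P in
  [/\ forall n : nat,
        lambda * (r n.+1 + r n) =
        Rn n ^+ 2 - Rn n * (2 * n%:R + 1 + alpha + beta + lambda)
        + lambda * alpha,
      forall n : nat, (1 <= n)%N ->
        n%:R * (n%:R + beta) + (2 * n%:R + alpha + beta) * r n =
        (r n ^+ 2 - alpha * r n) *
        (lambda ^+ 2 / (Rn n * Rn n.-1) - lambda / Rn n - lambda / Rn n.-1),
      r 0%N = 0 &
      Rn 0%N =
        (alpha + beta + 1) * kummer alpha (1 + alpha + beta) (- lambda)
        / kummer (1 + alpha) (2 + alpha + beta) (- lambda)].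
Proof.
case: hP => Pms Porth r Rn.
have P_monic n : P n \is monic by have [] := Pms n.
have P_size n : size (P n) = n.+1 by have [] := Pms n.
pose M := moment alpha beta lambda.
have M_linear : forall c p q, M (c *: p + q) = c * M p + M q by exact: moment_linear.
have M_pearson := moment_pearson lambda halpha hbeta.
have P_orth m n : m != n -> M (P m * P n * 'X) = 0.
  move=> /Porth <-; rewrite /M -int01_weight//.
  by apply: eq_Rintegral => x _; rewrite hornerM.
have hE n : sqnorm alpha beta lambda P n = M (P n ^+ 2 * 'X).
  rewrite /M -int01_weight//.
  by apply: eq_Rintegral => x _; rewrite horner_exp.
have RE n : Rn n = alpha / M (P n ^+ 2 * 'X) * M (P n ^+ 2).
  rewrite /Rn /aux_R hE; congr (_ * _).
  by apply: eq_Rintegral => x _; rewrite horner_exp; ring.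
have rE n : r n.+1 = alpha / M (P n ^+ 2 * 'X) * M (P n.+1 * P n).
  rewrite /r /aux_r hE; congr (_ * _).
  by apply: eq_Rintegral => x _; rewrite hornerM; ring.
have h_gt0 n : 0 < M (P n ^+ 2 * 'X) by apply: moment_sqr_gt0; rewrite ?monic_neq0.
have h_neq0 n : M (P n ^+ 2 * 'X) != 0 by rewrite gt_eqF.
have MP2_neq0 n : M (P n ^+ 2) != 0.
  by rewrite gt_eqF// (lt_le_trans (h_gt0 n))// moment_sqr_MX_le.
have a_neq0 : alpha != 0 by rewrite gt_eqF.
split=> //.
- move=> n.
  have := difference_eq1 M_linear M_pearson P_monic P_size P_orth h_neq0 n.
  by rewrite RE rE; case: n => [|n]; rewrite ?rE.
- case=> // n _.
  have := difference_eq2 M_linear M_pearson P_monic P_size P_orth h_neq0 a_neq0 MP2_neq0 n.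
  by rewrite !RE rE.
have P0 : P 0%N = 1.
  have := P_size 0%N; move/eqP/size_poly1P => [c _ Pc].
  by have := P_monic 0%N; rewrite Pc monicE lead_coefC => /eqP ->.
have := moment_kummer lambda halpha hbeta 0.
have := moment_kummer lambda halpha hbeta 1.
have M1 := moment_Xn_gt0 halpha hbeta 1.
have m1 := moment_Xn_succ halpha hbeta 0.
(* This makes the Kummer function in the denominator nonzero. *)
have MX : M 'X^1 != 0 by have := h_neq0 0%N; rewrite P0 expr1n mul1r.
rewrite m1 !addr0 in M1 *; rewrite -/M => k1 k0.
(* As [P 0] is 1, R_0 is [alpha] times the moment of 1 over that of ['X]; their ratio at parameter 0
   supplies the prefactor [alpha + beta + 1]. *)
rewrite RE P0 expr1n mul1r -['X]expr1 -[1](expr0 'X) k0.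
move: MX; rewrite k1.
have -> : 1 + alpha + beta + 1 = 2 + alpha + beta by ring.
rewrite [alpha + 1]addrC.
rewrite mulf_eq0 => /norP[K2 _].
have m0 := lt0r_neq0 (moment_Xn_gt0 halpha hbeta 0).
have s0 : 1 + alpha + beta != 0 by rewrite gt_eqF// !addr_gt0.
by field; rewrite K2 m0 s0 a_neq0.
Qed.
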